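(* Let $q\ge 1$ and $p \geq 2$ be integers. The $p$-aided rank of the $q$-th Coppersmith–Winograd tensor $T_{CW,q}$ is given by $$R^{\blacksquare p}(T_{CW,q}) = q+1 + \left\lceil \frac{q + 2}{p} \right\rceil.$$
   Context: Let $V_1 \simeq V_2 \simeq V_3 \simeq \mathbb{C}^{q+2}$ with fixed basis $e_0, \ldots ,e_{q+1}$. The $q$-th Coppersmith–Winograd tensor is $$T_{CW,q} = \sum_{i = 1}^{q} (e_0 \otimes e_i \otimes e_i + e_i \otimes e_0 \otimes e_i + e_i \otimes e_i \otimes e_0) + e_{q+1}\otimes e_{0} \otimes e_{0} + e_{0}\otimes e_{q+1} \otimes e_{0} + e_{0}\otimes e_{0} \otimes e_{q+1}\in V_1 \otimes V_2\otimes V_3.$$ A tensor $T \in U_1 \otimes U_2 \otimes U_3$ restricts to $S \in V_1\otimes V_2\otimes V_3$, written $T\ge S$, if there are linear maps $A_i: U_i\to V_i$ ($i=1,2,3$) with $S=(A_1\otimes A_2\otimes A_3)T$. The unit tensor is $\langle r \rangle = \sum_{i=1}^r e_i\otimes e_i\otimes e_i\in\mathbb{C}^r\otimes\mathbb{C}^r\otimes\mathbb{C}^r$. For $p\ge 1$, $T^{\blacksquare p} = T\boxtimes\langle 1,1,p\rangle\in U_1\otimes(U_2\otimes\mathbb{C}^p)\otimes(U_3\otimes\mathbb{C}^p)$, where $\boxtimes$ is the Kronecker product and $\langle 1,1,p\rangle = e_1\otimes\sum_{l=1}^p e_l\otimes e_l \in \mathbb{C}^1\otimes\mathbb{C}^p\otimes\mathbb{C}^p$.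 Explicitly, if $T=\sum T_{ijk}\,e_i\otimes e_j\otimes e_k$ in bases, then $T^{\blacksquare p}=\sum_{i,j,k}\sum_{l=1}^p T_{ijk}\, e_i\otimes(e_j\otimes e_l)\otimes(e_k\otimes e_l)$. The $p$-th aided rank of a tensor $S$ is $R^{\blacksquare p}(S)=\min\{r:\langle r\rangle^{\blacksquare p}\ge S\}$. *)

(* Defs.v *)
From HB Require Import structures.
From mathcomp Require Import all_boot all_order all_algebra.
From mathcomp Require Import boolp reals complex.

Set Implicit Arguments.
Unset Strict Implicit.
Unset Printing Implicit Defensive.

Import Order.TTheory GRing.Theory Num.Theory.
Local Open Scope ring_scope.

(* [vec F I] is F^I with its standard basis [e i]; a tensor product of such
   spaces is given by coordinates in the product basis, so that
   F^J (x) F^L = F^(J * L) with e_j (x) e_l = e (j, l). *)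
Notation vec F I := {ffun I -> F^o}.
Notation tensor F I J K := {ffun I * J * K -> F^o}.

Definition e (F : fieldType) (I : finType) (i : I) : vec F I :=
  [ffun j => (j == i)%:R].
Arguments e {F I} i.

Definition tens (F : fieldType) (I J K : finType)
    (u : vec F I) (v : vec F J) (w : vec F K) : tensor F I J K :=
  [ffun x => u x.1.1 * v x.1.2 * w x.2].

(* (A1 (x) A2 (x) A3) T *)
Definition tensor_map (F : fieldType) (I1 I2 I3 J1 J2 J3 : finType)
    (A1 : vec F I1 -> vec F J1) (A2 : vec F I2 -> vec F J2)
    (A3 : vec F I3 -> vec F J3) (T : tensor F I1 I2 I3) : tensor F J1 J2 J3 :=
  \sum_(i : I1) \sum_(j : I2) \sum_(k : I3)
    T (i, j, k) *: tens (A1 (e i)) (A2 (e j)) (A3 (e k)).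

Definition restricts (F : fieldType) (I1 I2 I3 J1 J2 J3 : finType)
    (T : tensor F I1 I2 I3) (S : tensor F J1 J2 J3) : Prop :=
  exists (A1 : {linear vec F I1 -> vec F J1})
         (A2 : {linear vec F I2 -> vec F J2})
         (A3 : {linear vec F I3 -> vec F J3}),
    S = tensor_map A1 A2 A3 T.

Definition unit_tensor (F : fieldType) (r : nat) : tensor F 'I_r 'I_r 'I_r :=
  \sum_(i < r) tens (e i) (e i) (e i).

Definition kronecker (F : fieldType) (I J K I' J' K' : finType)
    (T : tensor F I J K) (S : tensor F I' J' K') :
    tensor F (I * I')%type (J * J')%type (K * K')%type :=
  [ffun x => T (x.1.1.1, x.1.2.1, x.2.1) * S (x.1.1.2, x.1.2.2, x.2.2)].

(* The matrix multiplication tensor <1,1,p>. *)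
Definition mm11 (F : fieldType) (p : nat) : tensor F 'I_1 'I_p 'I_p :=
  \sum_(l < p) tens (e ord0) (e l) (e l).

(* T [x] <1,1,p>, where the first factor U1 (x) F^1 is identified with U1. *)
Definition aided (F : fieldType) (I J K : finType) (p : nat)
    (T : tensor F I J K) : tensor F I (J * 'I_p)%type (K * 'I_p)%type :=
  [ffun x => kronecker T (mm11 F p) ((x.1.1, ord0), x.1.2, x.2)].

Lemma tensor_basisE (F : fieldType) (I J K : finType) (T : tensor F I J K) :
  T = \sum_(i : I) \sum_(j : J) \sum_(k : K)
        T (i, j, k) *: tens (e i) (e j) (e k).
Proof.
apply/ffunP=> -[[a b] c].
rewrite sum_ffunE (bigD1 a) //= [X in _ + X]big1 ?addr0; last first.
  move=> i ia; rewrite sum_ffunE big1 // => j _; rewrite sum_ffunE big1 // => k _.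
  by rewrite !ffunE /= eq_sym (negbTE ia) !mul0r scaler0.
rewrite sum_ffunE (bigD1 b) //= [X in _ + X]big1 ?addr0; last first.
  move=> j jb; rewrite sum_ffunE big1 // => k _.
  by rewrite !ffunE /= [b == j]eq_sym (negbTE jb) mulr0 mul0r scaler0.
rewrite sum_ffunE (bigD1 c) //= [X in _ + X]big1 ?addr0; last first.
  by move=> k kc; rewrite !ffunE /= [c == k]eq_sym (negbTE kc) mulr0 scaler0.
by rewrite !ffunE /= !eqxx !mulr1 /GRing.scale /= mulr1.
Qed.

Lemma aidedE (F : fieldType) (I J K : finType) (p : nat) (T : tensor F I J K) :
  aided p T = \sum_(i : I) \sum_(j : J) \sum_(k : K) \sum_(l < p)
                T (i, j, k) *: tens (e i) (e (j, l)) (e (k, l)).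
Proof.
apply/ffunP=> -[[a [b m]] [c n]].
rewrite !ffunE /= {1}[T]tensor_basisE /mm11.
rewrite !sum_ffunE mulr_suml; apply: eq_bigr => i _.
rewrite !sum_ffunE mulr_suml; apply: eq_bigr => j _.
rewrite !sum_ffunE mulr_suml; apply: eq_bigr => k _.
rewrite !sum_ffunE mulr_sumr; apply: eq_bigr => l _.
rewrite !ffunE /= mul1r -scalerAl !xpair_eqE -!mulnb !natrM.
by rewrite -!mulrA [(c == k)%:R * ((m == l)%:R * _)]mulrCA.
Qed.

(* The minimum of {r | <r> aided by p restricts to S}, with value 0 when that
   set is empty, which can only happen when p = 0. *)
Definition aided_rank (F : fieldType) (J1 J2 J3 : finType) (p : nat)
    (S : tensor F J1 J2 J3) : nat :=
  match pselect (exists r, `[< restricts (aided p (unit_tensor F r)) S >]) with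
  | left ex_r => ex_minn ex_r
  | right _ => 0
  end.

Definition CW (F : fieldType) (q : nat) : tensor F 'I_q.+2 'I_q.+2 'I_q.+2 :=
  let e0 := e ord0 in
  let eq1 := e ord_max in
  \sum_(i < q.+2 | (1 <= i <= q)%N)
     (tens e0 (e i) (e i) + tens (e i) e0 (e i) + tens (e i) (e i) e0)
  + tens eq1 e0 e0 + tens e0 eq1 e0 + tens e0 e0 eq1.

(* Main.v *)
From HB Require Import structures.
Require Import Defs.
From mathcomp Require Import all_boot all_order all_algebra.
From mathcomp Require Import perm boolp reals complex.
From mathcomp Require Import ring.

Set Implicit Arguments.
Unset Strict Implicit.
Unset Printing Implicit Defensive.

Import Order.TTheory GRing.Theory Num.Theory.
Local Open Scope ring_scope.

(** A restriction of the [p]-aided unit tensor of size [r] to [T] is the same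
    as a decomposition [T = sum_(i < r) a_i (x) M_i] with matrices [M_i] of rank
    at most [p] ([restricts_aided_unitP]).  So the aided rank is the least
    number of matrices of rank at most [p] whose span contains every
    contraction [T(x)] of [T] by a linear form [x] on its first factor.

    For the Coppersmith-Winograd tensor, [T(x)] is [x_0] times a permutation
    matrix plus a matrix supported on the first row and the first column
    ([contract_CW]).

    Upper bound.  The [q + 1] slices with [x_0 = 0] have rank at most
    [2 <= p].  The remaining slice is cut into blocks of at most [p] rows, which
    takes [ceil ((q + 2) / p)] further matrices
    ([restricts_aided_unit_upper]).

    Lower bound.  The map [x |-> T(x)] is injective ([CW_concise]), so the
    vectors [a_i] span [F^(q+2)]; hence [q + 1] of them complete [e_0] to a
    basis.  A form [x] with [x_0 = 1] that vanishes on these [q + 1] vectors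
    writes [T(x)] with the [r - (q + 1)] other matrices only, while [x_0 = 1]
    forces [T(x)] to be invertible ([CW_full_rank]).  Therefore
    [q + 2 <= (r - (q + 1)) * p] ([restricts_aided_unit_lower]). *)

(** * Restrictions of the aided unit tensor *)

Section LinearExtension.
Variables (F : fieldType) (I J : finType) (f : I -> vec F J).

Definition linear_ext (v : vec F I) : vec F J := \sum_i v i *: f i.

Lemma linear_ext_is_linear : linear linear_ext.
Proof.
move=> c u v; rewrite /linear_ext scaler_sumr -big_split; apply: eq_bigr => i _.
by rewrite !ffunE scalerDl scalerA.
Qed.

HB.instance Definition _ :=
  GRing.isLinear.Build F (vec F I) (vec F J) *:%R linear_ext
    linear_ext_is_linear.

Lemma linear_ext_e i : linear_ext (e i) = f i.
Proof.
rewrite /linear_ext (bigD1 i) //= big1 => [|j ji].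
  by rewrite ffunE eqxx scale1r addr0.
by rewrite ffunE (negbTE ji) scale0r.
Qed.

End LinearExtension.

Section UnitTensor.
Variables (F : fieldType) (r p : nat).

Lemma unit_tensorE (i j k : 'I_r) :
  unit_tensor F r (i, j, k) = ((j == i) && (k == i))%:R.
Proof.
rewrite sum_ffunE (bigD1 i) //= big1 => [|i' i'i].
  by rewrite !ffunE /= eqxx mul1r addr0 -natrM mulnb.
by rewrite !ffunE /= eq_sym (negbTE i'i) !mul0r.
Qed.

Lemma aided_unitE (i : 'I_r) (jl km : 'I_r * 'I_p) :
  aided p (unit_tensor F r) (i, jl, km) = ((jl.1 == i) && (km == jl))%:R.
Proof.
case: jl km => [j l] [k m]; rewrite !ffunE /= unit_tensorE sum_ffunE.
rewrite (bigD1 l) //= big1 => [|l' l'l]; last first.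
  by rewrite !ffunE /= [l == l']eq_sym (negbTE l'l) mulr0 mul0r.
rewrite !ffunE /= !eqxx !mul1r addr0 -natrM mulnb xpair_eqE.
by case: (j =P i) => [->|].
Qed.

Lemma tensor_map_aided_unit (J1 J2 J3 : finType)
    (A1 : vec F 'I_r -> vec F J1) (A2 : vec F ('I_r * 'I_p)%type -> vec F J2)
    (A3 : vec F ('I_r * 'I_p)%type -> vec F J3) x y z :
  tensor_map A1 A2 A3 (aided p (unit_tensor F r)) (x, y, z) =
    \sum_(i < r) A1 (e i) x *
      \sum_(l < p) A2 (e (i, l)) y * A3 (e (i, l)) z.
Proof.
rewrite /tensor_map sum_ffunE; apply: eq_bigr => i _.
rewrite sum_ffunE.
transitivity (\sum_j \sum_l (j == i)%:R *
  (A1 (e i) x * (A2 (e (j, l)) y * A3 (e (j, l)) z))).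
  rewrite pair_bigA; apply: eq_bigr => -[j l] _ /=.
  rewrite sum_ffunE (bigD1 (j, l)) //= big1 ?addr0 => [|km kmj].
    by rewrite ffunE aided_unitE eqxx andbT [tens _ _ _ _]ffunE /= -mulrA.
  by rewrite ffunE aided_unitE (negbTE kmj) andbF scale0r.
rewrite (bigD1 i) //= [X in _ + X]big1 ?addr0 => [|j ji].
  by rewrite mulr_sumr; apply: eq_bigr => l _; rewrite eqxx mul1r.
by rewrite big1 // => l _; rewrite (negbTE ji) mul0r.
Qed.

End UnitTensor.

Lemma mxrank_leP (F : fieldType) m n (M : 'M[F]_(m, n)) p :
  (\rank M <= p)%N <-> exists (B : 'M_(m, p)) (C : 'M_(p, n)), M = B *m C.
Proof.
split=> [rkM | [B [C ->]]]; last exact: mulmx_max_rank.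
exists (col_ebase M *m pid_mx (\rank M)), (pid_mx (\rank M) *m row_ebase M).
by rewrite mulmxA -(mulmxA (col_ebase M)) pid_mx_id // mulmx_ebase.
Qed.

Section AidedDecomposition.
Variables (F : fieldType) (n m k : nat) (T : tensor F 'I_n 'I_m 'I_k).

(** The aided unit tensor is [sum_i e_i (x) sum_l e_(i, l) (x) e_(i, l)].  Its
    image under three linear maps has [i]-th term a vector times a sum of [p]
    products of vectors, and the images of the basis vectors are arbitrary. *)
Lemma restricts_aided_unitP r p :
  restricts (aided p (unit_tensor F r)) T <->
  exists (A : 'M[F]_(r, n)) (M : 'I_r -> 'M[F]_(m, k)),
    (forall i, \rank (M i) <= p)%N /\
    forall x y z, T (x, y, z) = \sum_i A i x * M i y z.
Proof.
split=> [[A1 [A2 [A3 ->]]] | [A [M [rkM defT]]]].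
  exists (\matrix_(i, x) A1 (e i) x), (fun i =>
    (\matrix_(y < m, l < p) A2 (e (i, l)) y) *m
    (\matrix_(l < p, z < k) A3 (e (i, l)) z)).
  split=> [i | x y z]; first exact: mulmx_max_rank.
  rewrite tensor_map_aided_unit; apply: eq_bigr => i _; rewrite !mxE.
  by congr (_ * _); apply: eq_bigr => l _; rewrite !mxE.
have /choice[B /choice[C defM]] i := (mxrank_leP (M i) p).1 (rkM i).
exists (linear_ext (fun i => [ffun x => A i x] : vec F 'I_n)).
exists (linear_ext
  (fun il : 'I_r * 'I_p => [ffun y => B il.1 y il.2] : vec F 'I_m)).
exists (linear_ext
  (fun il : 'I_r * 'I_p => [ffun z => C il.1 il.2 z] : vec F 'I_k)).
apply/ffunP=> -[[x y] z]; rewrite tensor_map_aided_unit defT.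
apply: eq_bigr => i _; rewrite /= linear_ext_e ffunE defM mxE.
by congr (_ * _); apply: eq_bigr => l _; rewrite !linear_ext_e !ffunE.
Qed.

Definition contract (x : 'cV[F]_n) : 'M[F]_(m, k) :=
  \matrix_(y, z) \sum_j x j 0 * T (j, y, z).

End AidedDecomposition.

Lemma aided_rank_eq (F : fieldType) (J1 J2 J3 : finType) p
    (S : tensor F J1 J2 J3) r :
    restricts (aided p (unit_tensor F r)) S ->
    (forall r', restricts (aided p (unit_tensor F r')) S -> r <= r')%N ->
  aided_rank p S = r.
Proof.
move=> Sr minr; rewrite /aided_rank.
case: pselect => [ex_r | []]; last by exists r; apply/asboolP.
case: ex_minnP => r' /asboolP Sr' minr'.
by apply/eqP; rewrite eqn_leq minr // minr' //; apply/asboolP.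
Qed.

(** * The lower bound *)

Lemma mxrank_sum_le (F : fieldType) m k (I : finType) (P : pred I)
    (M : I -> 'M[F]_(m, k)) p :
  (forall i, \rank (M i) <= p)%N -> (\rank (\sum_(i | P i) M i)%R <= #|P| * p)%N.
Proof.
move=> rkM; rewrite -sum_nat_const.
elim/big_ind2: _ => [|B b C c rkB rkC|i _]; first by rewrite mxrank0.
  exact: leq_trans (mxrank_add B C) (leq_add rkB rkC).
exact: rkM.
Qed.

(** The rows of an injective [A] span the space of row vectors, so [n] of them
    complete the first basis vector to a basis.  The form [x] is the one that
    takes the value [1] on that basis vector and vanishes on these rows. *)
Lemma exists_vanishing_affine (F : fieldType) r n (A : 'M[F]_(r, 1 + n)) :
    (forall x : 'cV_(1 + n), A *m x = 0 -> x = 0) ->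
  exists x : 'cV[F]_(1 + n),
    x 0 0 = 1 /\ (#|[set i | ((A *m x) i 0 != 0)%R]| + n <= r)%N.
Proof.
move=> injA.
(* The columns of A other than the first are independent, so some n rows of
   rsubmx A form an invertible matrix. *)
have fullA : row_full (rsubmx A).
  rewrite /row_full -mxrank_tr; apply: inj_row_free => v vA0.
  have Av0 : rsubmx A *m v^T = 0.
    by rewrite -[rsubmx A]trmxK -trmx_mul vA0 trmx0.
  have /injA : A *m col_mx 0 v^T = 0.
    by rewrite -[A]hsubmxK mul_row_col mulmx0 add0r Av0.
  rewrite -col_mx0 => /eq_col_mx[_ v0]; by apply: trmx_inj; rewrite v0 trmx0.
pose f := fullrankfun fullA.
pose y := - (invmx (rowsub f (rsubmx A)) *m rowsub f (lsubmx A)).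
exists (col_mx 1%:M y); split.
  transitivity (col_mx (1%:M : 'M[F]_1) y (lshift n 0) 0).
    by congr (col_mx _ _ _ _); apply: val_inj.
  by rewrite col_mxEu mxE eqxx.
have Ax0 : rowsub f (A *m col_mx 1%:M y) = 0.
  rewrite -[A]hsubmxK mul_row_col mulmx1 linearD /= -mul_rowsub_mx mulmxN.
  by rewrite mulKVmx ?fullrowsub_unit // subrr.
have cardf : #|[set f i | i : 'I_n]| = n.
  by rewrite card_imset ?card_ord //; apply: fullrankfun_inj.
rewrite -[X in (_ + X <= _)%N]cardf -[X in (_ <= X)%N]card_ord -cardsUI.
rewrite (_ : _ :&: _ = set0) ?cards0 ?addn0 ?max_card //.
apply/setP=> j; rewrite !inE; apply/negP=> /andP[/eqP Axj /imsetP[i _ defj]].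
by apply: Axj; move/matrixP/(_ i 0): Ax0; rewrite mxE -defj => ->; rewrite mxE.
Qed.

(** The substitution method: [T(x)] is the combination of the matrices [M_i] with
    coefficients [x(a_i)], and [x] can be chosen so that [n] of these vanish. *)
Lemma restricts_aided_unit_lower (F : fieldType) n m k
    (T : tensor F 'I_(1 + n) 'I_m 'I_k) r p c :
    (forall x, contract T x = 0 -> x = 0) ->
    (forall x : 'cV_(1 + n), x 0 0 = 1 -> (c <= \rank (contract T x))%N) ->
    restricts (aided p (unit_tensor F r)) T ->
  (n <= r)%N /\ (c <= (r - n) * p)%N.
Proof.
move=> concise rkT /restricts_aided_unitP[A [M [rkM defT]]].
have contractE x : contract T x = \sum_i (A *m x) i 0 *: M i.
  apply/matrixP=> y z; rewrite mxE summxE.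
  under [RHS]eq_bigr => i _ do rewrite 2!mxE mulr_suml.
  rewrite exchange_big; apply: eq_bigr => j _.
  rewrite defT mulr_sumr; apply: eq_bigr => i _.
  by rewrite mulrCA mulrA.
have injA (x : 'cV_(1 + n)) : A *m x = 0 -> x = 0.
  move=> Ax0; apply: concise; rewrite contractE big1 // => i _.
  by rewrite Ax0 mxE scale0r.
have [x [x0 cardx]] := exists_vanishing_affine injA.
split; first exact: leq_trans (leq_addl _ _) cardx.
apply: leq_trans (rkT x x0) _; rewrite contractE.
rewrite (bigID (fun i => (A *m x) i 0 != 0)) /=.
rewrite [X in _ + X]big1 ?addr0; last first.
  by move=> i /negPn/eqP ->; rewrite scale0r.
apply: leq_trans (mxrank_sum_le (p := p) _ _) _ => [i|].
  exact: leq_trans (mxrank_scale _ _) (rkM i).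
rewrite leq_mul2r leq_subRL ?(leq_trans (leq_addl _ _) cardx) //.
by rewrite addnC -cardsE cardx orbT.
Qed.

(** * The upper bound *)

(** The summands are the blocks of [p] consecutive rows. *)
Lemma mx_sum_low_rank (F : fieldType) m k s p (M : 'M[F]_(m, k)) :
    (m <= s * p)%N ->
  exists N : 'I_s -> 'M[F]_(m, k),
    (forall u, \rank (N u) <= p)%N /\ M = \sum_u N u.
Proof.
move=> le_m_sp.
(* P u *m (P u)^T is the diagonal projector onto the rows u * p + l, l < p. *)
pose P (u : 'I_s) : 'M[F]_(m, p) := \matrix_(y, l) (y == u * p + l :> nat)%N%:R.
exists (fun u => P u *m ((P u)^T *m M)).
split=> [u|]; first exact: mulmx_max_rank.
under eq_bigr do rewrite mulmxA.
rewrite -mulmx_suml [X in X *m _](_ : _ = 1%:M) ?mul1mx //.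
apply/matrixP=> y z; rewrite summxE mxE.
have p_gt0 : (0 < p)%N.
  rewrite lt0n; apply: contraTneq (leq_trans (ltn_ord y) le_m_sp) => ->.
  by rewrite muln0.
have lt_ys : (y %/ p < s)%N.
  by rewrite ltn_divLR // (leq_trans (ltn_ord y)).
have lt_yp : (y %% p < p)%N by rewrite ltn_mod.
rewrite (bigD1 (Ordinal lt_ys)) //= mxE (bigD1 (Ordinal lt_yp)) //=.
rewrite !mxE /= -divn_eq eqxx mul1r eq_sym -val_eqE.
rewrite !big1 ?addr0 // => [u neq_u | l neq_l].
  rewrite mxE big1 // => l _; rewrite !mxE.
  case: eqP => [def_y|]; rewrite ?mul0r //; case/eqP: neq_u; apply: val_inj => /=.
  by rewrite def_y divnMDl // divn_small ?addn0.
rewrite !mxE; case: eqP => [def_y|]; rewrite ?mul0r //.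
case/eqP: neq_l; apply: val_inj => /=.
by rewrite def_y modnMDl modn_small.
Qed.

(** The first row and the first column each contribute at most one. *)
Lemma mxrank_hook (F : fieldType) m k (M : 'M[F]_(m.+1, k.+1)) :
  (forall y z, y != 0 -> z != 0 -> M y z = 0) -> (\rank M <= 2)%N.
Proof.
move=> hookM.
pose w : 'cV[F]_m.+1 := \col_y ((y != 0)%:R * M y 0).
have -> : M = delta_mx 0 0 *m row 0 M + w *m (delta_mx 0 0 : 'rV_k.+1).
  apply/matrixP=> y z; rewrite !mxE !big_ord1 !mxE eqxx /= andbT.
  case: (altP (y =P 0)) => [->|y0]; first by rewrite mul1r !mul0r addr0.
  rewrite mul0r add0r mul1r.
  case: (altP (z =P 0)) => [->|z0]; first by rewrite mulr1.
  by rewrite hookM ?mulr0.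
apply: leq_trans (mxrank_add _ _) _.
exact: leq_add (mulmx_max_rank _ _) (mulmx_max_rank _ _).
Qed.

(** Each slice other than the first is used as a single matrix; the first slice,
    whatever its rank, is a sum of [s] matrices of rank at most [p]. *)
Lemma restricts_aided_unit_upper (F : fieldType) n m k
    (T : tensor F 'I_(1 + n) 'I_m 'I_k) s p :
    (forall i, \rank (contract T (delta_mx (rshift 1 i) 0%R)) <= p)%N ->
    (m <= s * p)%N ->
  restricts (aided p (unit_tensor F (n + s))) T.
Proof.
move=> rkT le_m_sp; apply/restricts_aided_unitP.
have contractE j y z : contract T (delta_mx j 0) y z = T (j, y, z).
  rewrite mxE (bigD1 j) //= big1 => [|j' j'j]; rewrite mxE.
    by rewrite !eqxx mul1r addr0.
  by rewrite (negbTE j'j) mul0r.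
have [N [rkN defN]] := mx_sum_low_rank (contract T (delta_mx 0 0)) le_m_sp.
(* The first n vectors are e_1, ..., e_n and the last s are all e_0. *)
exists (col_mx (row_mx 0 1%:M) (row_mx (const_mx 1) 0)).
exists (fun i => match split i with
  | inl i => contract T (delta_mx (rshift 1 i) 0) | inr u => N u end).
split=> [i|x y z]; first by case: split.
rewrite big_split_ord /=.
under eq_bigr => i _ do rewrite (unsplitK (inl i)) col_mxEu.
under [X in _ + X]eq_bigr => u _ do rewrite (unsplitK (inr u)) col_mxEd.
case: (split_ordP x) => j ->.
  rewrite big1 => [|i _]; last by rewrite row_mxEl mxE mul0r.
  rewrite add0r; under eq_bigr => u _ do rewrite row_mxEl mxE mul1r.
  rewrite ord1 -summxE -defN -contractE.
  by congr (contract _ (delta_mx _ _) _ _); apply: val_inj.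
rewrite [X in _ + X]big1 => [|u _]; last by rewrite row_mxEr mxE mul0r.
rewrite addr0 (bigD1 j) //= big1 => [|i ij].
  by rewrite row_mxEr mxE eqxx mul1r addr0 contractE.
by rewrite row_mxEr mxE (negbTE ij) mul0r.
Qed.

(** * The Coppersmith-Winograd tensor *)

Section CoppersmithWinograd.
Variables (F : fieldType) (q : nat).

Let mid (y : 'I_q.+2) := (y != ord0) && (y != ord_max).
Let swap : 'S_q.+2 := tperm ord0 ord_max.

(** The terms are grouped by their first index.  Those starting with [e_0] sum to
    the permutation matrix that exchanges [e_0] and [e_(q+1)]; all the others
    have [e_0] as a second or third factor. *)
Lemma CW_entry (x y z : 'I_q.+2) :
  CW F q (x, y, z) =
    (x == ord0)%:R * (z == swap y)%:R
    + (x == z)%:R * (mid z && (y == ord0))%:R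
    + (x == y)%:R * (mid y && (z == ord0))%:R
    + (x == ord_max)%:R * ((y == ord0) && (z == ord0))%:R.
Proof.
have midE (i : 'I_q.+2) : (1 <= i <= q)%N = mid i.
  rewrite /mid -!val_eqE /= lt0n -ltnS [(i < _)%N]ltn_neqAle -ltnS ltn_ord.
  by rewrite andbT.
have sum_mid (f : 'I_q.+2 -> F) (t : 'I_q.+2) :
    \sum_(i < q.+2 | mid i) (t == i)%:R * f i = (mid t)%:R * f t.
  rewrite big_mkcond (bigD1 t) //= big1 ?addr0 => [|i it].
    by rewrite eqxx mul1r; case: ifP; rewrite ?mul1r ?mul0r.
  by rewrite eq_sym (negbTE it) mul0r if_same.
have swapE : (z == swap y)%:R = (mid y)%:R * (z == y)%:R
    + (y == ord_max)%:R * (z == ord0)%:R + (y == ord0)%:R * (z == ord_max)%:R :> F.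
  rewrite /swap /mid.
  case: tpermP => [->|->|/eqP/negPf -> /eqP/negPf ->]; rewrite ?eqxx /=;
    by rewrite ?mul0r ?mul1r ?addr0 ?add0r.
rewrite /CW !ffunE sum_ffunE.
under eq_bigl do rewrite midE.
rewrite (eq_bigr (fun i : 'I_q.+2 =>
    (y == i)%:R * ((x == ord0)%:R * (z == i)%:R)
    + (z == i)%:R * ((y == ord0)%:R * (x == i)%:R)
    + (y == i)%:R * ((z == ord0)%:R * (x == i)%:R) : F)); last first.
  by move=> i _; rewrite !ffunE /=; ring.
rewrite !big_split /=.
rewrite !sum_mid swapE -!mulnb !natrM.
ring.
Qed.

Lemma contract_CW (x : 'cV[F]_q.+2) (y z : 'I_q.+2) :
  contract (CW F q) x y z =
    x ord0 0 * (z == swap y)%:R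
    + x z 0 * (mid z && (y == ord0))%:R
    + x y 0 * (mid y && (z == ord0))%:R
    + x ord_max 0 * ((y == ord0) && (z == ord0))%:R.
Proof.
have sum_at (t : 'I_q.+2) (c : F) :
    \sum_(j < q.+2) x j 0 * ((j == t)%:R * c) = x t 0 * c.
  rewrite (bigD1 t) //= big1 ?addr0 ?eqxx ?mul1r // => j jt.
  by rewrite (negbTE jt) mul0r mulr0.
rewrite mxE; under eq_bigr => j _ do rewrite CW_entry !mulrDr.
by rewrite !big_split /= !sum_at.
Qed.

(** All coordinates of [x] can be read off the first row of its contraction. *)
Lemma CW_concise (x : 'cV[F]_q.+2) : contract (CW F q) x = 0 -> x = 0.
Proof.
move=> Mx0; apply/matrixP=> j k; rewrite ord1 [RHS]mxE.
have := congr1 (fun M : 'M_q.+2 => M ord0 (swap j)) Mx0.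
rewrite contract_CW [RHS]mxE => <-.
rewrite (inj_eq perm_inj) /mid eqxx /= mulr0 addr0 andbT /swap.
case: tpermP => [->|->|/eqP/negPf j0 /eqP/negPf jmax].
- by rewrite !eqxx /= mulr1 mulr0 !addr0.
- by rewrite !eqxx /= !mulr0 mulr1 !add0r.
- by rewrite j0 jmax /= !mulr0 mulr1 add0r addr0.
Qed.

Lemma CW_hook (i : 'I_q.+1) :
  (\rank (contract (CW F q) (delta_mx (rshift 1 i) 0%R)) <= 2)%N.
Proof.
apply: mxrank_hook => y z /negPf y0 /negPf z0.
by rewrite contract_CW y0 z0 !andbF !mulr0 !addr0 mxE mul0r.
Qed.

(** Exchanging the first and last columns makes the contraction upper triangular,
    with [x 0 0] on the diagonal.  A row vector in its kernel is therefore
    eliminated in the order: first coordinate, middle ones, last. *)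
Lemma CW_full_rank (x : 'cV[F]_q.+2) :
  x 0 0 = 1 -> \rank (contract (CW F q) x) = q.+2.
Proof.
move=> x0; apply/eqP; rewrite -[_ == _]/(row_free _).
set M := contract _ _.
have ME y z : z != ord0 ->
    M y z = (z == swap y)%:R + x z 0 * (mid z && (y == ord0))%:R.
  move=> /negPf z0.
  by rewrite /M contract_CW z0 !andbF !mulr0 !addr0 [x ord0 0]x0 mul1r.
apply: inj_row_free => u uM0.
have col0 z : \sum_y u 0 y * M y z = 0.
  by have := congr1 (fun v : 'rV_q.+2 => v 0 z) uM0; rewrite !mxE.
have u0 : u 0 ord0 = 0.
  rewrite -[RHS](col0 ord_max) (bigD1 ord0) //= big1 ?addr0 => [|y y0].
    by rewrite ME // /mid eqxx andbF mulr0 addr0 /swap tpermL eqxx mulr1.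
  rewrite ME // /mid eqxx andbF mulr0 addr0 /swap.
  by rewrite -{1}(tpermL ord0 ord_max) (inj_eq perm_inj) eq_sym (negPf y0) mulr0.
have umid y : y != ord_max -> u 0 y = 0.
  move=> ymax; have zy0 : swap y != ord0.
    by rewrite -(tpermR ord0 ord_max) (inj_eq perm_inj).
  rewrite -[RHS](col0 (swap y)) (bigD1 y) //= big1 ?addr0 => [|t ty].
    rewrite ME // eqxx; case: (altP (y =P ord0)) => [->|_].
      by rewrite u0 mul0r.
    by rewrite andbF mulr0 addr0 mulr1.
  case: (altP (t =P ord0)) => [->|t0]; first by rewrite u0 mul0r.
  rewrite ME // (negPf t0) andbF mulr0 addr0 (inj_eq perm_inj) eq_sym.
  by rewrite (negPf ty) mulr0.
apply/rowP=> y; rewrite [RHS]mxE.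
case: (altP (y =P ord_max)) => [->|]; last exact: umid.
rewrite -[RHS](col0 ord0) (bigD1 ord_max) //= big1 ?addr0 => [|t tmax].
  rewrite /M contract_CW /swap tpermR eqxx [x ord0 0]x0 /mid !eqxx !andbF /=.
  by rewrite !mulr0 !addr0 !mulr1.
by rewrite umid // mul0r.
Qed.

End CoppersmithWinograd.

Lemma ceil_natdiv (m p : nat) :
  (0 < p)%N -> Num.ceil (m.+1%:R / p%:R : rat) = (m %/ p).+1.
Proof.
move=> p_gt0; have p0 : 0 < p%:R :> rat by rewrite ltr0n.
apply: ceil_def; rewrite ltr_pdivlMr // ler_pdivrMr //.
rewrite -addn1 PoszD addrK -!natrM ltr_nat ler_nat ltnS leq_trunc_div.
by rewrite addn1 ltn_ceil.
Qed.

Theorem propositionC2 (R : realType) (q p : nat) (hq : (1 <= q)%N)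
    (hp : (2 <= p)%N) :
  (aided_rank p (CW R[i] q))%:Z =
    (q + 1)%:Z + Num.ceil ((q + 2)%:R / p%:R : rat).
Proof.
have p_gt0 : (0 < p)%N := ltnW hp.
rewrite addn2 ceil_natdiv // -PoszD addn1.
congr Posz; apply: aided_rank_eq => [|r].
  apply: restricts_aided_unit_upper => [i|]; last exact: ltn_ceil.
  exact: leq_trans (CW_hook _ i) hp.
move=> /(restricts_aided_unit_lower (n := q.+1) (c := q.+2)).
case=> [x|x x0|le_qr]; [exact: CW_concise | by rewrite CW_full_rank |].
by rewrite -ltn_divLR // ltn_subRL addnS.
Qed.
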